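(* Let $G$ be a finite group and let $N$ be a normal subgroup of $G$. Suppose $\mathrm{Irr}(G/N)=\{\beta_1,\dots,\beta_n\}$ (the $\beta_i$ being the distinct irreducible characters of $G/N$) and $\chi\in \mathrm{Irr}(G)$, and suppose that the characters $\beta_1\chi,\dots,\beta_n\chi$ of $G$ are distinct and irreducible. Then the restriction $\chi_N$ is an irreducible character of $N$.
   Context: Characters are ordinary complex characters; $\mathrm{Irr}(G)$ is the set of irreducible complex characters of $G$. Characters of $G/N$ are viewed as characters of $G$ by inflation, so $(\beta\chi)(g)=\beta(gN)\chi(g)$. $\chi_N$ denotes the restriction of $\chi$ to $N$. *)

(* Defs.v *)
From mathcomp Require Import all_boot all_order all_algebra.
From mathcomp Require Import all_fingroup all_solvable all_field all_character.

Set Implicit Arguments.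
Unset Strict Implicit.
Unset Printing Implicit Defensive.

(* Characters take values in algC, the algebraic complex numbers: every ordinary
   complex character of a finite group has values there, and irr G is the list
   of irreducible complex characters of G. *)

(* Main.v *)
Require Import Defs.
From mathcomp Require Import all_boot all_order all_algebra.
From mathcomp Require Import all_fingroup all_solvable all_field all_character.
Set Implicit Arguments.
Unset Strict Implicit.
Unset Printing Implicit Defensive.
Import GroupScope GRing.Theory.
Local Open Scope ring_scope.

(** The norm of the restriction is computed by Frobenius reciprocity:
    ['[chi_N] = '[chi, Ind (Res chi)] = '[chi, (Ind 1_N) * chi]], and [Ind 1_N]
    is the inflation of the regular character of [G / N], which is the sum of
    the [beta 1 *: beta] over the irreducible [beta] of [G / N].  Hence
    ['[chi_N]] is the sum of the [beta 1 * '[chi, beta * chi]].  The characters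
    [beta * chi] are distinct and irreducible, and the one for [beta = 1] is
    [chi] itself, so only that term survives and it equals 1.  A character of
    norm 1 is irreducible. *)

Lemma cfInd_cfun1_reg (gT : finGroupType) (G N : {group gT}) :
  N <| G -> 'Ind[G, N] 1 = (cfReg (G / N) %% N)%CF.
Proof.
move=> nsNG; have [sNG nNG] := andP nsNG.
rewrite cfInd_cfun1 //; apply/cfun_inP=> x Gx.
rewrite cfModE // cfRegE !cfunE cfuniE // card_quotient //.
by rewrite mulr_natr (sameP eqP (kerP _ (subsetP nNG x Gx))) ker_coset.
Qed.

Theorem theorem1 (gT : finGroupType) (G N : {group gT}) (nNG : N <| G)
    (chi : 'CF(G)) (irr_chi : chi \in irr G)
    (irr_prod : forall beta : 'CF(G / N), beta \in irr (G / N) ->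
       (beta %% N)%CF * chi \in irr G)
    (distinct_prod : {in irr (G / N) &,
       injective (fun beta : 'CF(G / N) => (beta %% N)%CF * chi)}) :
  'Res[N] chi \in irr N.
Proof.
have sNG := normal_sub nNG.
have dot_prod (i : Iirr (G / N)) :
  '[chi, ('chi_i %% N)%CF * chi] = (i == 0)%:R.
  have chi_prod1 : ('chi[G / N]_0 %% N)%CF * chi = chi.
    by rewrite irr0 cfMod_cfun1 mul1r.
  rewrite -{1}chi_prod1; have [-> | nz_i] := eqVneq i 0.
    by rewrite chi_prod1 irrWnorm.
  have /irrP[j Dj] := irr_prod _ (mem_irr 0).
  have /irrP[k Dk] := irr_prod _ (mem_irr i).
  rewrite Dj Dk cfdot_irr; case: eqP => // Djk; case/eqP: nz_i.
  by apply/irr_inj/distinct_prod; rewrite ?mem_irr //= Dj Dk Djk.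
rewrite irrEchar cfRes_char ?irr_char ?(irrWchar irr_chi) //=.
rewrite cfdot_Res_l -['Res[N] chi]mul1r cfIndM // cfInd_cfun1_reg //.
rewrite cfReg_sum rmorph_sum mulr_suml cfdot_sumr (bigD1 0) //=.
rewrite big1 => [|i nz_i]; rewrite linearZ -scalerAl cfdotZr dot_prod.
  by rewrite eqxx irr0 cfun11 rmorph1 mulr1 addr0.
by rewrite (negPf nz_i) mulr0.
Qed.
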